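(* Let $F$ be a linear cone over a totally ordered field $\mathbb{K}$. Then there exists a span of $F$, unique up to unique isomorphism, denoted $(\mathrm{span}(F),\iota)$. Moreover, the map $\iota:F\to\mathrm{span}(F)$ is injective, the image $\iota(F)\subseteq\mathrm{span}(F)$ is a generating convex cone in $\mathrm{span}(F)$, and $\mathrm{span}(F)=\{v-w: v,w\in\iota(F)\}$. If $F$ is proper, then so is $\iota(F)$.
   Context: A totally ordered field is a field $\mathbb{K}$ with a total order $\leq$ such that $\mu\le\lambda$ implies $\mu+\nu\le\lambda+\nu$ for all $\nu \in \mathbb{K}$, and $\lambda,\mu\ge 0$ implies $\lambda\mu\ge 0$; $\mathbb{K}_+=\{\lambda\in\mathbb{K}:\lambda\ge0\}$. A linear cone over $\mathbb{K}$ is a commutative, cancellative monoid $(F,+)$ with a scalar multiplication $\mathbb{K}_+\times F\to F$ such that $\lambda(v+w)=\lambda v+\lambda w$, $(\lambda+\mu)v=\lambda v+\mu v$, $\lambda(\mu v)=(\lambda\mu)v$, $1v=v$ for all $\lambda,\mu\in\mathbb{K}_+$, $v,w\in F$. It is proper if no $v\in F\setminus\{0\}$ has a negative (additive inverse) in $F$. If $W$ is a linear cone over $\mathbb{K}$ or a $\mathbb{K}$-vector space, a map $f:F\to W$ is $\mathbb{K}_+$-linear if $f(\lambda v+\mu w)=\lambda f(v)+\mu f(w)$ for all $\lambda,\mu\in\mathbb{K}_+$, $v,w\in F$. A span of $F$ is a $\mathbb{K}$-vector space $V$ together with a $\mathbb{K}_+$-linear map $\iota:F\to V$ such that for every $\mathbb{K}$-vector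 space $W$ and every $\mathbb{K}_+$-linear map $f:F\to W$ there is a unique $\mathbb{K}$-linear map $\tilde f:V\to W$ with $f=\tilde f\circ\iota$. ''Unique up to unique isomorphism'' means that for two spans $(V_1,\iota_1),(V_2,\iota_2)$ there is a unique $\mathbb{K}$-linear isomorphism $\Psi:V_1\to V_2$ with $\Psi\circ\iota_1=\iota_2$. A convex cone in a $\mathbb{K}$-vector space is a subset closed under addition and under multiplication by elements of $\mathbb{K}_+$; it is generating if its linear span is the whole vector space. *)

(* Defs.v *)
From HB Require Import structures.
From mathcomp Require Import all_boot all_order all_algebra.
From mathcomp Require Import boolp classical_sets.

Set Implicit Arguments.
Unset Strict Implicit.
Unset Printing Implicit Defensive.

Import Order.TTheory GRing.Theory Num.Theory.
Local Open Scope classical_set_scope.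
Local Open Scope ring_scope.

(* The semiring K_+ of nonnegative scalars. Totally ordered fields are          *)
(* realFieldType's: the norm of the latter is determined by the order.          *)
Record nonneg (K : realFieldType) :=
  Nonneg { nonneg_val :> K; _ : nonneg_val \is Num.nneg }.

HB.instance Definition _ (K : realFieldType) :=
  [isSub for @nonneg_val K].
HB.instance Definition _ (K : realFieldType) :=
  [Choice of nonneg K by <:].
HB.instance Definition _ (K : realFieldType) :=
  [SubChoice_isSubComNzSemiRing of nonneg K by <:].

(* Linear cones are the cancellative K_+-semimodules. The semimodule law        *)
(* 0 *: v = 0 adds nothing: it follows from cancellativity, see the factory     *)
(* isLinearCone below.                                                          *)
HB.mixin Record isCancellative F of GRing.Nmodule F := {
  coneIr : forall u v w : F, u + w = v + w -> u = v
}.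

#[short(type="linearConeType")]
HB.structure Definition LinearCone (K : realFieldType) :=
  {F of GRing.LSemiModule (nonneg K) F & isCancellative F}.

HB.factory Record isLinearCone (K : realFieldType) F of GRing.Nmodule F := {
  cone_addIr : forall u v w : F, u + w = v + w -> u = v;
  cone_scale : nonneg K -> F -> F;
  cone_scaleDr : forall a v w,
    cone_scale a (v + w) = cone_scale a v + cone_scale a w;
  cone_scaleDl : forall a b v,
    cone_scale (a + b) v = cone_scale a v + cone_scale b v;
  cone_scaleA : forall a b v,
    cone_scale a (cone_scale b v) = cone_scale (a * b) v;
  cone_scale1 : forall v, cone_scale 1 v = v
}.

HB.builders Context (K : realFieldType) F of isLinearCone K F.

Fact cone_scale0 v : cone_scale 0 v = 0.
Proof.
by apply: (@cone_addIr _ _ (cone_scale 0 v)); rewrite -cone_scaleDl !add0r.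
Qed.

HB.instance Definition _ := GRing.Nmodule_isLSemiModule.Build (nonneg K) F
  cone_scaleA cone_scale0 cone_scale1 cone_scaleDr
  (fun v a b => cone_scaleDl a b v).
HB.instance Definition _ := isCancellative.Build F cone_addIr.

HB.end.

Section Cones.
Variable K : realFieldType.

Definition nonneg_linear (F : linearConeType K) (W : lmodType K) (f : F -> W) :=
  forall (a b : nonneg K) (v w : F),
    f (a *: v + b *: w) = (a : K) *: f v + (b : K) *: f w.

Definition is_span (F : linearConeType K) (V : lmodType K) (iota : F -> V) :=
  nonneg_linear iota /\
  forall (W : lmodType K) (f : F -> W), nonneg_linear f ->
    exists g : {linear V -> W}, f =1 g \o iota /\
      forall g' : {linear V -> W}, f =1 g' \o iota -> g' =1 g.

Definition span_iso (F : linearConeType K) (V1 V2 : lmodType K)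
    (iota1 : F -> V1) (iota2 : F -> V2) (Psi : {linear V1 -> V2}) :=
  bijective Psi /\ Psi \o iota1 =1 iota2.

Definition convex_cone (V : lmodType K) (C : set V) :=
  (forall v w, C v -> C w -> C (v + w)) /\
  (forall (a : nonneg K) v, C v -> C ((a : K) *: v)).

Definition linear_span (V : lmodType K) (C : set V) : set V :=
  smallest [set U : set V | GRing.submod_closed (mem U)] C.

Definition generating (V : lmodType K) (C : set V) :=
  linear_span C = [set: V].

End Cones.

(* Stated for subsets so as to cover both a linear cone F, as [set: F], and a   *)
(* convex cone in a vector space.                                               *)
Definition proper_cone (M : nmodType) (C : set M) :=
  forall v, C v -> v <> 0 -> ~ exists2 w, C w & v + w = 0.

(* Main.v *)
Require Import Defs.
From HB Require Import structures.
From mathcomp Require Import all_boot all_order all_algebra.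
From mathcomp Require Import boolp classical_sets.
From mathcomp Require Import generic_quotient ring.

Set Implicit Arguments.
Unset Strict Implicit.
Unset Printing Implicit Defensive.

Import Order.TTheory GRing.Theory Num.Theory.
Local Open Scope classical_set_scope.
Local Open Scope ring_scope.

(** The span is the space of formal differences [v - w] of elements of the cone
    (the Grothendieck group of its additive monoid): pairs [(v, w)], where
    [(v, w)] and [(v', w')] are identified when [v + w' = v' + w].
    Cancellativity makes this relation transitive, and for pairs [(v, 0)] the
    relation is equality, so the cone embeds.

    A scalar [c] has to act although the cone only knows nonnegative ones. The
    field is itself the space of formal differences of its nonnegative part: if
    [c = a - b] with [a] and [b] nonnegative, then [c] should send [v - w] to
    [(a v + b w) - (a w + b v)]. The class of this pair depends only on [c] and
    on the class of [(v, w)] ([cone_span_scaleE]), so each axiom of a vector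
    space may be checked on decompositions of the scalars chosen to make both
    sides the same pair up to rearranging sums in the cone; the axioms need no
    case distinction on signs.

    A nonnegative-linear [f] extends to formal differences in the only possible
    way, [v - w |-> f v - f w], which is the universal property
    ([cone_in_is_span]). The universal property makes any two spans isomorphic
    over the cone ([span_unique]), so every span inherits from the space of
    formal differences that the cone embeds and that every vector is a
    difference of two elements of the cone. The second fact makes the image of
    the cone generating; it is a convex cone because the embedding is
    nonnegative-linear, and proper when the cone is because, moreover, the
    embedding is injective. *)

Local Open Scope quotient_scope.

(** * Nonnegative-linear maps *)

Section NonnegLinear.
Variables (K : realFieldType) (F : linearConeType K) (W : lmodType K).
Variables (f : F -> W) (linf : nonneg_linear f).

Lemma nonneg_linearD v w : f (v + w) = f v + f w.
Proof. by have := linf 1 1 v w; rewrite !scale1r. Qed.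

Lemma nonneg_linearZ (a : nonneg K) v : f (a *: v) = (a : K) *: f v.
Proof. by have := linf a 0 v v; rewrite !scale0r !addr0. Qed.

Lemma nonneg_linear0 : f 0 = 0.
Proof. by have := nonneg_linearZ 0 0; rewrite !scale0r. Qed.

Lemma range_convex_cone : convex_cone (range f).
Proof.
split=> [_ _ [v _ <-] [w _ <-] | a _ [v _ <-]].
  by exists (v + w); rewrite ?nonneg_linearD.
by exists (a *: v); rewrite ?nonneg_linearZ.
Qed.

(** The negative of [f v] in the range is some [f w]; then [f (v + w) = f 0], and
    injectivity makes [w] a negative of [v]. *)
Lemma range_proper_cone :
  injective f -> proper_cone [set: F] -> proper_cone (range f).
Proof.
move=> injf prF _ [v _ <-] fv0 [_ [w _ <-] fvw0]; apply: (prF v) => //.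
  by move=> v0; apply: fv0; rewrite v0 nonneg_linear0.
by exists w => //; apply: injf; rewrite nonneg_linearD fvw0 nonneg_linear0.
Qed.

End NonnegLinear.

Lemma differences_generating (K : realFieldType) (V : lmodType K) (C : set V) :
  [set: V] = [set v - w | v in C & w in C] -> generating C.
Proof.
move=> VE; apply/seteqP; split=> // x _ U [[U0 Ulin] CU].
have : [set: V] x by [].
rewrite VE => -[v Cv [w Cw <-]].
have Uv : v \in mem U by apply/mem_set/CU.
have Uw : w \in mem U by apply/mem_set/CU.
by have /set_mem := Ulin (- 1) w v Uw Uv; rewrite scaleN1r addrC.
Qed.

(** * The space of formal differences *)

Section Differences.
Variables (K : realFieldType) (F : linearConeType K).
Implicit Types (x y z : F * F) (a b : nonneg K) (c d : K).

Definition diff_eq x y : bool := `[< x.1 + y.2 = y.1 + x.2 >].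

Lemma diff_eq_refl : reflexive diff_eq.
Proof. by move=> x; apply/asboolP. Qed.

Lemma diff_eq_sym : symmetric diff_eq.
Proof. by move=> x y; apply/asboolP/asboolP. Qed.

Lemma diff_eq_trans : transitive diff_eq.
Proof.
move=> y x z /asboolP xy /asboolP yz; apply/asboolP.
(* Adding the two equations leaves [y.2] on both sides, to be cancelled. *)
apply: (coneIr _ _ y.2).
by rewrite addrAC xy addrAC yz addrAC.
Qed.

Canonical diff_equiv := EquivRel diff_eq diff_eq_refl diff_eq_sym diff_eq_trans.

Definition cone_span := {eq_quot diff_eq}.
HB.instance Definition _ := Choice.on cone_span.
HB.instance Definition _ : EqQuotient _ diff_eq cone_span :=
  EqQuotient.on cone_span.

Definition diff x : cone_span := \pi_cone_span x.

Lemma diffP x y : diff x = diff y <-> x.1 + y.2 = y.1 + x.2.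
Proof.
by rewrite /diff; split=> [/eqquotP/asboolP | ?] //; apply/eqquotP/asboolP.
Qed.

Lemma diff_repr (u : cone_span) : diff (repr u) = u.
Proof. exact: reprK. Qed.

Lemma repr_diff x : (repr (diff x)).1 + x.2 = x.1 + (repr (diff x)).2.
Proof. by apply/diffP; rewrite diff_repr. Qed.

Definition cone_span_add (u v : cone_span) := diff (repr u + repr v).
Definition swap x := (x.2, x.1).
Definition cone_span_opp (u : cone_span) := diff (swap (repr u)).

Lemma cone_span_addE x y : cone_span_add (diff x) (diff y) = diff (x + y).
Proof. by apply/diffP; rewrite /= addrACA !repr_diff addrACA. Qed.

Lemma cone_span_oppE x : cone_span_opp (diff x) = diff (swap x).
Proof. by apply/diffP; rewrite /= addrC -repr_diff addrC. Qed.

Lemma cone_span_addA : associative cone_span_add.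
Proof.
move=> u v w; rewrite -(diff_repr u) -(diff_repr v) -(diff_repr w).
by rewrite !cone_span_addE addrA.
Qed.

Lemma cone_span_addC : commutative cone_span_add.
Proof. by move=> u v; rewrite /cone_span_add addrC. Qed.

Lemma cone_span_add0v : left_id (diff 0) cone_span_add.
Proof. by move=> u; rewrite -(diff_repr u) cone_span_addE add0r. Qed.

Lemma cone_span_oppK : left_inverse (diff 0) cone_span_opp cone_span_add.
Proof.
move=> u; rewrite -(diff_repr u) cone_span_oppE cone_span_addE.
by apply/diffP; rewrite /= addr0 add0r addrC.
Qed.

HB.instance Definition _ := GRing.isZmodule.Build cone_span
  cone_span_addA cone_span_addC cone_span_add0v cone_span_oppK.

Lemma diffD x y : diff x + diff y = diff (x + y).
Proof. exact: cone_span_addE. Qed.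

(** The pair representing [a - b] times the formal difference [x]. *)
Definition pair_scale a b x : F * F :=
  (a *: x.1 + b *: x.2, a *: x.2 + b *: x.1).

Lemma max0_nneg c : Num.max c 0 \is Num.nneg.
Proof. by rewrite nnegrE le_max lexx orbT. Qed.

Definition pos_part c : nonneg K := Nonneg (max0_nneg c).

Lemma pos_partB c : c = (pos_part c : K) - (pos_part (- c) : K).
Proof.
rewrite /=; case: (leP c 0) => c0.
  by rewrite max_l ?opprK ?add0r // oppr_ge0.
by rewrite max_r ?subr0 // oppr_le0 ltW.
Qed.

Definition cone_span_scale c (u : cone_span) :=
  diff (pair_scale (pos_part c) (pos_part (- c)) (repr u)).

(** In both arguments, equality of differences amounts to an equation between
    sums, [x.1 + y.2 = y.1 + x.2] in the cone and [a + b' = a' + b] among the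
    nonnegative scalars, so distributivity lets it pass through the action. *)
Lemma pair_scale_eq a b a' b' x y :
  (a : K) - (b : K) = (a' : K) - (b' : K) -> diff x = diff y ->
  diff (pair_scale a b x) = diff (pair_scale a' b' y).
Proof.
move=> ab /diffP xy; transitivity (diff (pair_scale a b y)); apply/diffP => /=.
  by rewrite addrACA [RHS]addrACA -!scalerDr [x.2 + _]addrC [y.2 + _]addrC xy.
have {}ab : a + b' = a' + b.
  apply: val_inj => /=; apply/eqP.
  by rewrite -subr_eq -addrA [_ - _]addrC addrA ab addrNK.
rewrite [a' *: y.2 + _]addrC [a *: y.2 + _]addrC.
by rewrite addrACA [RHS]addrACA -!scalerDl ab [b + a']addrC [b' + a]addrC ab.
Qed.

Lemma cone_span_scaleE c a b x :
  c = (a : K) - (b : K) -> cone_span_scale c (diff x) = diff (pair_scale a b x).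
Proof.
by move=> ->; apply: pair_scale_eq; rewrite ?diff_repr // -pos_partB.
Qed.

Lemma cone_span_scaleA c d u :
  cone_span_scale c (cone_span_scale d u) = cone_span_scale (c * d) u.
Proof.
rewrite -(diff_repr u) (cone_span_scaleE _ (pos_partB d)).
rewrite (cone_span_scaleE _ (pos_partB c)).
set a := pos_part c; set a' := pos_part (- c).
set b := pos_part d; set b' := pos_part (- d).
(* [(a - a') (b - b')], expanded and sorted by sign. *)
rewrite (@cone_span_scaleE _ (a * b + a' * b') (a * b' + a' * b)); last first.
  rewrite {1}(pos_partB c) {1}(pos_partB d) -/a -/a' -/b -/b' /=.
  ring.
congr diff; congr pair; rewrite /= !scalerDr !scalerDl !scalerA;
  by rewrite [(a' * b) *: _ + _]addrC addrACA.
Qed.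

Lemma cone_span_scale1 : left_id 1 cone_span_scale.
Proof.
move=> u; rewrite -(diff_repr u) (@cone_span_scaleE _ 1 0) ?subr0 //.
by congr diff; rewrite /pair_scale !scale1r !scale0r !addr0 -surjective_pairing.
Qed.

Lemma cone_span_scaleDr : right_distributive cone_span_scale +%R.
Proof.
move=> c u v; rewrite -(diff_repr u) -(diff_repr v) diffD.
rewrite !(cone_span_scaleE _ (pos_partB c)) diffD; congr diff.
by congr pair; rewrite /= !scalerDr addrACA.
Qed.

Lemma cone_span_scaleDl u : {morph cone_span_scale^~ u : c d / c + d}.
Proof.
move=> c d; rewrite -(diff_repr u) (cone_span_scaleE _ (pos_partB c)).
rewrite (cone_span_scaleE _ (pos_partB d)) diffD.
rewrite (@cone_span_scaleE _ (pos_part c + pos_part d)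
                       (pos_part (- c) + pos_part (- d))).
  by congr diff; congr pair; rewrite /= !scalerDl addrACA.
by rewrite {1}(pos_partB c) {1}(pos_partB d) addrACA -opprD.
Qed.

HB.instance Definition _ := GRing.Zmodule_isLmodule.Build K cone_span
  cone_span_scaleA cone_span_scale1 cone_span_scaleDr cone_span_scaleDl.

Lemma scale_diff c a b x :
  c = (a : K) - (b : K) -> c *: diff x = diff (pair_scale a b x).
Proof. exact: cone_span_scaleE. Qed.

Definition cone_in (v : F) : cone_span := diff (v, 0).

Lemma cone_in_linear : nonneg_linear cone_in.
Proof.
have coneZ a v : (a : K) *: cone_in v = cone_in (a *: v).
  rewrite (@scale_diff _ a 0) ?subr0 //.
  by congr diff; rewrite /pair_scale /= !scaler0 scale0r !addr0.
by move=> a b v w; rewrite !coneZ diffD; congr diff; congr pair; rewrite addr0.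
Qed.

Lemma cone_in_inj : injective cone_in.
Proof. by move=> v w /diffP /=; rewrite !addr0. Qed.

Lemma diffE x : diff x = cone_in x.1 - cone_in x.2.
Proof.
rewrite [- _]cone_span_oppE diffD; congr diff; case: x => v w.
by congr pair; rewrite /= ?addr0 ?add0r.
Qed.

Section Lift.
Variables (W : lmodType K) (f : F -> W) (linf : nonneg_linear f).

(** The linearity proof is an argument so that the linear structure of the
    extension can be inferred from it. *)
Definition lift of nonneg_linear f :=
  fun u : cone_span => f (repr u).1 - f (repr u).2.

Lemma lift_diff x : lift linf (diff x) = f x.1 - f x.2.
Proof.
apply/eqP; rewrite subr_eq addrAC eq_sym subr_eq.
by rewrite -!nonneg_linearD // repr_diff.
Qed.

Lemma lift_linear : linear (lift linf).
Proof.
move=> c u v; rewrite -(diff_repr u) -(diff_repr v).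
rewrite (scale_diff _ (pos_partB c)) diffD !lift_diff /=.
rewrite !nonneg_linearD // !nonneg_linearZ //.
rewrite [X in _ = X *: _ + _](pos_partB c) scalerBl !scalerBr opprB.
by rewrite opprD addrACA; congr (_ + _); rewrite opprD addrACA.
Qed.

HB.instance Definition _ := GRing.isLinear.Build K cone_span W *:%R
  (lift linf) lift_linear.

Lemma lift_cone_in : f =1 lift linf \o cone_in.
Proof. by move=> v; rewrite /= lift_diff /= nonneg_linear0 // subr0. Qed.

End Lift.

Lemma cone_in_is_span : is_span cone_in.
Proof.
split=> [|W f linf]; first exact: cone_in_linear.
exists (lift linf : {linear cone_span -> W}).
split=> [|g fg]; first exact: lift_cone_in.
by move=> u; rewrite -(diff_repr u) [in LHS]diffE linearB [RHS]lift_diff !fg.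
Qed.

End Differences.

(** * Uniqueness, and the properties of an arbitrary span *)

Section Spans.
Variables (K : realFieldType) (F : linearConeType K).

(** The identity is the only linear extension of [iota] along itself. *)
Lemma span_endo_id (V : lmodType K) (iota : F -> V) (g : {linear V -> V}) :
  is_span iota -> iota =1 g \o iota -> g =1 id.
Proof.
move=> [lini univ] gi; have [h [_ huniq]] := univ _ _ lini.
move=> u; rewrite (huniq g) //.
by rewrite -(huniq (idfun : {linear V -> V})).
Qed.

(** The comparison maps in the two directions compose to endomorphisms over the
    cone, which are identities. *)
Lemma span_unique (V1 V2 : lmodType K) (iota1 : F -> V1) (iota2 : F -> V2) :
  is_span iota1 -> is_span iota2 ->
  exists Psi : {linear V1 -> V2}, span_iso iota1 iota2 Psi /\
    forall Psi' : {linear V1 -> V2},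
      span_iso iota1 iota2 Psi' -> Psi' =1 Psi.
Proof.
move=> s1 s2; have [lin1 univ1] := s1; have [lin2 univ2] := s2.
have [Psi [Psi1 Psiuniq]] := univ1 _ _ lin2.
have [Phi [Phi2 _]] := univ2 _ _ lin1.
exists Psi; split; last by move=> Psi' [_ e]; apply: Psiuniq => v; rewrite -e.
split; last by move=> v; rewrite Psi1.
exists Phi.
  apply: (@span_endo_id _ _ (Phi \o Psi : {linear V1 -> V1}) s1) => v.
  by rewrite Phi2 /= [iota2 v]Psi1.
apply: (@span_endo_id _ _ (Psi \o Phi : {linear V2 -> V2}) s2) => v.
by rewrite Psi1 /= [iota1 v]Phi2.
Qed.

Variables (V : lmodType K) (iota : F -> V) (siota : is_span iota).

(** By the universal property, the embedding into the space of formal differences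
    factors through [iota]. *)
Lemma span_inj : injective iota.
Proof.
have [g [gi _]] := siota.2 _ _ (@cone_in_linear K F).
by move=> v w e; apply: cone_in_inj; rewrite !gi /= e.
Qed.

(** Transported from the space of formal differences by the isomorphism between
    the two spans. *)
Lemma span_differences :
  [set: V] = [set v - w | v in range iota & w in range iota].
Proof.
apply/seteqP; split=> // x _.
have [Psi [[[Phi _ PsiK] Psii] _]] := span_unique (@cone_in_is_span K F) siota.
rewrite -(PsiK x) -(diff_repr (Phi x)) diffE linearB.
exists (iota (repr (Phi x)).1); first by exists (repr (Phi x)).1.
exists (iota (repr (Phi x)).2); first by exists (repr (Phi x)).2.
by rewrite -!Psii.
Qed.

End Spans.

Theorem theorem2p7 (K : realFieldType) (F : linearConeType K) :
  (exists (V : lmodType K) (iota : F -> V), is_span iota) /\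
  (forall (V1 V2 : lmodType K) (iota1 : F -> V1) (iota2 : F -> V2),
     is_span iota1 -> is_span iota2 ->
     exists Psi : {linear V1 -> V2}, span_iso iota1 iota2 Psi /\
       forall Psi' : {linear V1 -> V2},
         span_iso iota1 iota2 Psi' -> Psi' =1 Psi) /\
  (forall (V : lmodType K) (iota : F -> V), is_span iota ->
     [/\ injective iota,
         convex_cone (range iota),
         generating (range iota),
         [set: V] = [set v - w | v in range iota & w in range iota] &
         proper_cone [set: F] -> proper_cone (range iota)]).
Proof.
split; first by exists (cone_span F), (@cone_in K F); apply: cone_in_is_span.
split=> [|V iota siota]; first exact: span_unique.
have [lini _] := siota; have VE := span_differences siota.
split=> //; first exact: span_inj; first exact: range_convex_cone.
  exact: differences_generating.
by apply: range_proper_cone => //; exact: span_inj.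
Qed.
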